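(* Let $m\ge1$ and let $c(x,y)=\ln\langle x,y\rangle$ for $x,y\in\mathbb{R}^m_+$. Let $\pi$ be a Borel probability measure on $\mathbb{R}^m_+\times\mathbb{R}^m_+$ such that there exists a compact set $K\subset\mathbb{R}^m_+\times\mathbb{R}^m_+$ with $\pi(K)=1$, and let $\mu$ and $\nu$ be the projections of $\pi$ onto the first and second factors respectively. The following statements are equivalent: 1) $\pi$ is a solution to the Monge--Kantorovich problem with marginals $\mu,\nu$ and the cost function $c$; 2) there exists a $c$-cyclically monotone set $\Gamma\subset\mathbb{R}^m_+\times\mathbb{R}^m_+$ satisfying $\pi(\Gamma)=1$; 3) $\pi$ admits a positive homogeneous utility function $u$.
   Context: Notation: $\mathbb{R}_+=(0,+\infty)$, so $\mathbb{R}^m_+$ is the set of vectors with strictly positive coordinates; $\langle\cdot,\cdot\rangle$ is the standard scalar product. Monge--Kantorovich problem: given probability measures $\mu,\nu$ on $\mathbb{R}^m_+$ and a cost function $c$, let $P_{\mu,\nu}$ be the set of Borel probability measures on $\mathbb{R}^m_+\times\mathbb{R}^m_+$ whose projections onto the first and second factors are $\mu$ and $\nu$ respectively. A measure $P$ solves the Monge--Kantorovich problem with marginals $\mu,\nu$ and cost $c$ if $P\in P_{\mu,\nu}$ and $P$ minimizes $\int c(x,y)\,dP$ over $P_{\mu,\nu}$. $c$-cyclical monotonicity: a set $A\subset\mathbb{R}^m_+\times\mathbb{R}^m_+$ is $c$-cyclically monotone if every finite subset $\{(x_i,y_i),\ 1\le i\le k\}\subset A$ (with any enumeration of its elements) satisfies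 $\sum_{i=1}^k c(x_i,y_i)\le\sum_{i=1}^k c(x_i,y_{i+1})$, where $y_{k+1}=y_1$. Utility function: $\pi$ admits a utility function $u:\mathbb{R}^m_+\to\mathbb{R}$ if for $\pi$-almost all $(x,y)$ and every $z\in\mathbb{R}^m_+$ with $\langle z,y\rangle<\langle x,y\rangle$ one has $u(z)<u(x)$ (the exceptional $\pi$-null set of pairs $(x,y)$ does not depend on $z$). The function $u$ is positive homogeneous if $u>0$ and $u(tx)=t\,u(x)$ for all $x\in\mathbb{R}^m_+$, $t\in\mathbb{R}_+$. *)

(* Defs.v *)
From HB Require Import structures.
From mathcomp Require Import all_boot all_order all_algebra.
From mathcomp Require Import all_classical all_reals all_analysis.

Set Implicit Arguments.
Unset Strict Implicit.
Unset Printing Implicit Defensive.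

Import Order.TTheory GRing.Theory Num.Theory.
Import numFieldNormedType.Exports.

Local Open Scope classical_set_scope.
Local Open Scope ring_scope.

Definition pos_orthant (R : realType) (m : nat) : set 'rV[R]_m :=
  [set x | forall i, 0 < x ord0 i].

Definition posvec (R : realType) (m : nat) : Type :=
  set_type (@pos_orthant R m).

HB.instance Definition _ (R : realType) (m : nat) :=
  PseudoMetric.copy (posvec R m) (set_type (@pos_orthant R m)).

Section posvec_pointed.
Context (R : realType) (m : nat).

Lemma const1_pos_orthant : (const_mx 1 : 'rV[R]_m) \in @pos_orthant R m.
Proof. by rewrite inE => i; rewrite mxE. Qed.

HB.instance Definition _ :=
  isPointed.Build (posvec R m) (exist _ (const_mx 1) const1_pos_orthant).

End posvec_pointed.

(* The sigma-algebra is the Borel one for the subspace topology. *)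
HB.instance Definition _ (R : realType) (m : nat) :=
  Measurable.copy (posvec R m)
    (g_sigma_algebraType (@open (posvec R m))).

Section posvec_borel_prod.
Context (R : realType) (m : nat).
Local Notation V := (posvec R m).

Let rbox (k : 'rV[rat]_m * nat) : set V :=
  (set_val @^-1` (ball (map_mx ratr k.1 : 'rV[R]_m) k.2.+1%:R^-1))°.

Let open_rbox k : open (rbox k).
Proof. exact: open_interior. Qed.

Let rboxP (x : V) (U : set V) : nbhs x U ->
  exists2 k, rbox k x & rbox k `<=` U.
Proof.
move=> /nbhs_ballP[e /= e0 xeU].
have [n ne] : exists n : nat, n.+1%:R^-1 < e / 2.
  by have := near_infty_natSinv_lt (PosNum (divr_gt0 e0 (ltr0Sn R 1)));
    move=> [N _ /(_ N (leqnn N))]; exists N.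
set r : R := n.+1%:R^-1 in ne *.
have r0 : 0 < r by rewrite invr_gt0.
have r20 : 0 < r / 2 by rewrite divr_gt0.
have /choice[q qP] (j : 'I_m) :
    exists p : rat, `|\val x ord0 j - ratr p| < r / 2.
  have [|p] := @rat_in_itvoo R (\val x ord0 j - r / 2) (\val x ord0 j + r / 2).
    by rewrite ltrD2l (lt_trans _ r20)// oppr_lt0.
  by rewrite in_itv/= => pP; exists p; rewrite ltr_distlC.
pose Q : 'rV[R]_m := map_mx ratr (\row_j q j).
have xQ : ball (\val x) (r / 2) Q.
  by split => // i j; rewrite !mxE (ord1 i); exact: qP.
exists (\row_j q j, n).
  apply/nbhs_ballP; exists (r / 2) => // y /= xy.
  by rewrite /= [X in ball _ X](splitr r); apply: ball_triangle;
    [exact/ball_sym/xQ|].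
move=> y /interior_subset /= Qy; apply: xeU.
apply: (@le_ball _ _ _ (r / 2 + r)); last exact: ball_triangle xQ Qy.
rewrite [leRHS](splitr e) lerD ?ltW//.
by rewrite (lt_trans _ ne)// gtr_pMr// invf_lt1// ltr1n.
Qed.

(* The product sigma-algebra that the library puts on the pairs is also the
   Borel sigma-algebra of the product topology. *)
Lemma posvec_prod_borelE :
  (measurable : set (set (V * V))) = <<s @open (V * V)%type >>.
Proof.
rewrite eqEsubset; split.
  apply: smallest_sub; first exact: smallest_sigma_algebra.
  have pre (f : V * V -> V) : continuous f ->
      preimage_set_system setT f measurable `<=` <<s @open (V * V)%type >>.
    move=> cf; rewrite -(g_sigma_preimageE).
    apply: smallest_sub; first exact: smallest_sigma_algebra.
    move=> _ [A oA <-]; rewrite setTI; apply: sub_sigma_algebra.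
    by apply: open_comp => // z _; exact: cf.
  by rewrite subUset; split; apply: pre => z; [exact: cvg_fst|exact: cvg_snd].
apply: smallest_sub; first exact: sigma_algebra_measurable.
move=> U oU.
pose D := [set kl | rbox kl.1 `*` rbox kl.2 `<=` U].
have -> : U = \bigcup_(kl in D) (rbox kl.1 `*` rbox kl.2).
  rewrite eqEsubset; split=> [[x y] Uxy|z [kl Dkl klz]]; last exact: Dkl.
  have [[A B] /= [xA yB] ABU] : nbhs (x, y) U by exact: open_nbhs_nbhs.
  have [k kx kA] := rboxP xA.
  have [l ly lB] := rboxP yB.
  by exists (k, l) => // -[a b] [/= /kA Aa /lB Bb]; exact: ABU.
rewrite bigcup_mkcond; apply: countable_bigcupT_measurable => // kl.
by case: ifPn => // _; apply: measurableX;
  apply: sub_sigma_algebra; exact: open_rbox.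
Qed.

End posvec_borel_prod.

Definition dotp (R : realType) (m : nat) (x y : posvec R m) : R :=
  \sum_(i < m) set_val x ord0 i * set_val y ord0 i.

Definition log_cost (R : realType) (m : nat) (x y : posvec R m) : R :=
  ln (dotp x y).

Lemma scale_pos_orthant (R : realType) (m : nat) (t : R) (x : posvec R m) :
  0 < t -> t *: set_val x \in @pos_orthant R m.
Proof.
move=> t0; rewrite inE => i; rewrite mxE mulr_gt0//.
by have := set_valP x; apply.
Qed.

Definition pscale (R : realType) (m : nat) (t : R) (t_gt0 : 0 < t)
    (x : posvec R m) : posvec R m :=
  exist _ (t *: set_val x) (scale_pos_orthant x t_gt0).

Section monge_kantorovich.
Context d1 d2 (X : measurableType d1) (Y : measurableType d2) (R : realType).
Implicit Types (P : probability (X * Y)%type R) (c : X -> Y -> R).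

(* The marginals are compared on measurable sets only: the value of a measure
   on other sets is unconstrained. *)
Definition coupling (mu : probability X R) (nu : probability Y R) :
    set (probability (X * Y)%type R) :=
  [set P | (forall A, measurable A -> pushforward P fst A = mu A) /\
           (forall B, measurable B -> pushforward P snd B = nu B)].

Definition solves_MK (mu : probability X R) (nu : probability Y R) c P : Prop :=
  coupling mu nu P /\
  forall Q, coupling mu nu Q ->
    (\int[P]_z (c z.1 z.2)%:E <= \int[Q]_z (c z.1 z.2)%:E)%E.

End monge_kantorovich.

(* A finite set of k + 1 pairs with an enumeration of its elements is an
   injective family; [ordS] is the cyclic successor. *)
Definition cyclically_monotone (X Y : Type) (R : realType) (c : X -> Y -> R)
    (A : set (X * Y)) : Prop :=
  forall (k : nat) (p : 'I_k.+1 -> X * Y), injective p -> (forall i, A (p i)) ->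
    \sum_i c (p i).1 (p i).2 <= \sum_i c (p i).1 (p (ordS i)).2.

Definition is_utility_for (R : realType) (m : nat)
    (P : probability (posvec R m * posvec R m)%type R)
    (u : posvec R m -> R) : Prop :=
  {ae P, forall xy, forall z : posvec R m,
    dotp z xy.2 < dotp xy.1 xy.2 -> u z < u xy.1}.

Definition positive_homogeneous (R : realType) (m : nat)
    (u : posvec R m -> R) : Prop :=
  (forall x, 0 < u x) /\
  forall (x : posvec R m) (t : R) (t_gt0 : 0 < t),
    u (pscale t_gt0 x) = t * u x.

(* Main.v *)
(* 1 => 2: cut a box carrying the measure into countably many cells on which
   the logarithms of the coordinates vary little, and let the set consist of
   the points lying in no null cell. A cycle of such points violating
   monotonicity yields a cheaper coupling: the measure conditioned on the
   cells of the cycle is partly recoupled along the cycle.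
   2 => 3: the least cost f of a chain in the set satisfies
   f z - c(z, y) <= f x - c(x, y) on it; it is 1-Lipschitz in the logarithms of
   the coordinates and f(t x) = ln t + f x, so u = exp f is homogeneous.
   3 => 1: homogeneity turns the utility inequality into
   u z <x, y> <= u x <z, y>, which summed along cycles gives monotonicity; then
   the potential f and its conjugate g satisfy f x + g y <= c(x, y), with
   equality almost everywhere. *)
Require Import Defs.
From mathcomp Require Import all_boot all_order all_algebra.
From mathcomp Require Import all_classical all_reals all_analysis.
From mathcomp Require Import measurable_realfun zify ring lra.

Set Implicit Arguments.
Unset Strict Implicit.
Unset Printing Implicit Defensive.

Import Order.TTheory GRing.Theory Num.Theory.
Import numFieldNormedType.Exports.

Local Open Scope classical_set_scope.
Local Open Scope ring_scope.

Lemma nuniq_split (T : eqType) (s : seq T) : ~~ uniq s ->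
  exists b s1 s2 s3, s = s1 ++ b :: s2 ++ b :: s3.
Proof.
elim: s => //= a s IH; rewrite negb_and negbK => /orP[|/IH].
  by case/splitPr => s2 s3; exists a, [::], s2, s3.
by move=> [b [s1 [s2 [s3 ->]]]]; exists b, (a :: s1), s2, s3.
Qed.

(** * Costs of chains and cycles of pairs *)

Section chains.
Context (X Y : choiceType) (R : realType).
Variable c : X -> Y -> R.

(** The extra cost when [a] takes the target of [b] in place of its own; cyclical monotonicity asks
    these increments to have a nonnegative sum around a cycle. *)
Definition exchange (a b : X * Y) : R := c a.1 b.2 - c a.1 a.2.

Fixpoint chain_cost (a : X * Y) (s : seq (X * Y)) : R :=
  if s is b :: s' then exchange a b + chain_cost b s' else 0.

Lemma chain_cost_cat a s t :
  chain_cost a (s ++ t) = chain_cost a s + chain_cost (last a s) t.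
Proof. by elim: s a => [|b s IH] a /=; rewrite ?add0r// IH addrA. Qed.

Lemma chain_costE a s :
  chain_cost a s = \sum_(i < size s) exchange (nth a (a :: s) i) (nth a s i).
Proof.
elim: s a => [|b s IH] a /=; first by rewrite big_ord0.
rewrite big_ord_recl /= IH; congr (_ + _); apply: eq_bigr => i _.
by congr exchange; apply: set_nth_default => //=; rewrite ltnS ltnW.
Qed.

Variable A : set (X * Y).
Hypothesis cmA : cyclically_monotone c A.

(** A list without repetition is an injective family, so [cmA] applies; the wrap-around of [ordS] is
    the closing step back to [a]. *)
Lemma uniq_cycle_ge0 a s : uniq (a :: s) -> (forall b, b \in a :: s -> A b) ->
  0 <= chain_cost a (rcons s a).
Proof.
move=> us As; pose p (i : 'I_(size s).+1) := nth a (a :: s) i.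
have pinj : injective p.
  by move=> i j /eqP; rewrite nth_uniq// => /eqP/val_inj.
have /(_ _)/wrap[i|] := cmA pinj; first exact/As/mem_nth.
rewrite -subr_ge0 -sumrB chain_costE size_rcons => /le_trans; apply.
rewrite le_eqVlt; apply/orP; left; apply/eqP/eq_bigr => i _.
have pE : nth a (a :: rcons s a) i = p i.
  by rewrite /p -rcons_cons nth_rcons/= ltn_ord.
rewrite pE /exchange; congr (c _ _.2 - _).
rewrite /p nth_rcons /=.
case: ltnP => [si|si]; first by rewrite modn_small.
have -> : val i = size s by apply/eqP; rewrite eqn_leq si -ltnS ltn_ord.
by rewrite modnn eqxx.
Qed.

(* A repetition splits a cycle into two shorter ones. *)
Lemma cycle_ge0 a s : (forall b, b \in a :: s -> A b) ->
  0 <= chain_cost a (rcons s a).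
Proof.
have [n] := ubnP (size s); elim: n a s => // n IH a s; rewrite ltnS => sn As.
have [/uniq_cycle_ge0|/nuniq_split[b [[|a1 s1] [s2 [s3]]]]] :=
  boolP (uniq (a :: s)); first exact.
  (* The repeated element is the base point: the cycle is one loop at [a] followed by another. *)
  move=> /= [ab sE]; subst b s.
  rewrite -cats1 -catA /= -cat_rcons chain_cost_cat last_rcons cats1.
  rewrite addr_ge0 ?IH//.
- move: sn; rewrite size_cat/=; lia.
- move=> x; rewrite inE => /orP[/eqP ->|xs]; apply: As; rewrite ?mem_head//.
  by rewrite inE mem_cat xs orbT.
- move: sn; rewrite size_cat/=; lia.
- move=> x xs; apply: As; rewrite inE mem_cat; move: xs.
  by rewrite !inE => /orP[->|->]; rewrite ?orbT.
(* The repetition lies inside: the loop from [b] to [b] through [s2] is cut out, leaving the cycle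
   through [s1], [b], [s3]. *)
move=> /= [aE sE]; subst a1 s.
have -> : rcons (s1 ++ b :: s2 ++ b :: s3) a =
    (s1 ++ [:: b]) ++ rcons s2 b ++ rcons s3 a.
  by rewrite -!cats1 -!catA /= -!catA.
have := IH a (s1 ++ b :: s3); rewrite rcons_cat/= chain_cost_cat/= => IH1.
rewrite !chain_cost_cat !last_cat/= addr0 addrCA addr_ge0//.
  apply: (IH b s2).
    by move: sn; rewrite !size_cat/= size_cat/=; lia.
  move=> x; rewrite inE => /orP[/eqP ->|xs]; apply: As.
    by rewrite inE mem_cat mem_head !orbT.
  by rewrite inE mem_cat inE mem_cat xs !orbT.
rewrite -addrA last_rcons; apply: IH1.
  by move: sn; rewrite !size_cat/= size_cat/=; lia.
move=> x; rewrite inE => /orP[/eqP ->|]; first by apply: As; rewrite mem_head.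
rewrite mem_cat inE => /or3P[xs|/eqP ->|xs]; apply: As.
- by rewrite inE mem_cat xs orbT.
- by rewrite inE mem_cat mem_head !orbT.
- by rewrite inE mem_cat inE mem_cat inE xs !orbT.
Qed.

End chains.

(** * Potentials and conjugates for a general cost *)

Section potentials.
Context (R : realType).

(** A uniform comparison of costs passes to infima of functions [c x y + b]. For the logarithmic
    cost this single property yields both continuity and homogeneity. *)
Definition cost_regular X Y (c : X -> Y -> R) (f : X -> R) : Prop :=
  forall x x' D, (forall y, c x' y <= c x y + D) -> f x' <= f x + D.

Definition bounded_oscillation X Y (c : X -> Y -> R) : Prop :=
  forall x x', exists D, forall y, c x' y <= c x y + D.

(** Serves twice: [S] records the remainders of chains for the potential, and the values [- f x] for
    its conjugate. *)
Lemma cost_infimum X Y (c : X -> Y -> R) (S : set (Y * R)) :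
    S !=set0 -> (forall x, has_lbound [set c x s.1 + s.2 | s in S]) ->
  exists f : X -> R, [/\ cost_regular c f,
    forall x y b, S (y, b) -> f x <= c x y + b &
    forall x l, (forall y b, S (y, b) -> l <= c x y + b) -> l <= f x].
Proof.
move=> [s0 Ss0] lb; pose I x := [set c x s.1 + s.2 | s in S].
have I0 x : I x !=set0 by exists (c x s0.1 + s0.2), s0.
have fle x y b : S (y, b) -> inf (I x) <= c x y + b.
  by move=> Syb; apply: (ge_inf (lb x)); exists (y, b).
have lef x l : (forall y b, S (y, b) -> l <= c x y + b) -> l <= inf (I x).
  by move=> Sl; apply: lb_le_inf => // _ [[y b] Syb <-]; exact: Sl.
exists (fun x => inf (I x)); split => // x x' D xx'.
rewrite -lerBlDr; apply: lef => y b Syb.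
by rewrite lerBlDr (le_trans (fle x' y b Syb))// addrAC lerD2r.
Qed.

(* The potential of Rochet and Rüschendorf: the least cost of a chain in [A]
   from [x] to a fixed point of [A]. *)
Lemma monotone_potential (X Y : choiceType) (c : X -> Y -> R)
    (A : set (X * Y)) :
    cyclically_monotone c A -> A !=set0 -> bounded_oscillation c ->
  exists f : X -> R, [/\ cost_regular c f,
    exists y b, forall x, f x <= c x y + b &
    forall a z, A a -> f z + c a.1 a.2 <= f a.1 + c z a.2].
Proof.
move=> cmA [q0 Aq0] osc.
(* [c x y + b] is the cost of going from [x] through [q :: s] to [q0], every point of the chain
   giving back its own cost. Subtracting the last one makes the infimum vanish at [q0.1]. *)
pose S : set (Y * R) := [set yb | exists q s,
  [/\ forall b, b \in q :: s -> A b, last q s = q0 &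
      yb = (q.2, chain_cost c q s - c q0.1 q0.2)]].
have Sq0 : S (q0.2, - c q0.1 q0.2).
  exists q0, [::]; split=> //=; last by rewrite sub0r.
  by move=> b; rewrite inE => /eqP ->.
have [|x|f [freg fle lef]] := @cost_infimum _ _ c S.
- by eexists; exact: Sq0.
(* Starting at [q0.1] instead of [x] changes the cost by a bounded amount and closes the chain into
   a cycle, whose cost is nonnegative. *)
- have [D hD] := osc x q0.1.
  exists (- D) => _ [_ [q [s [As sq ->]]] <-] /=.
  have /(_ _)/wrap[b|] := @cycle_ge0 _ _ _ c _ cmA q0 (belast q s).
    by rewrite inE => /orP[/eqP ->//|/mem_belast]; exact: As.
  rewrite -{2}sq -lastI/= /exchange.
  by have := hD q.2; lra.
exists f; split=> //.
  by exists q0.2, (- c q0.1 q0.2) => x; exact: fle.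
(* Putting [a] in front of a chain that starts from [a.1] gives a chain that is admissible from
   [z]. *)
move=> a z Aa; rewrite -lerBlDr; apply: lef => _ _ [q [s [As sq [-> ->]]]].
have /(fle z) : S (a.2, exchange c a q + chain_cost c q s - c q0.1 q0.2).
  by exists a, (q :: s); split=> // b; rewrite inE => /orP[/eqP ->//|/As].
by rewrite /exchange; lra.
Qed.

(** [g y] is the infimum over [x] of [c x y - f x]; the upper bound on [f] and the oscillation bound
    keep it finite, and the last clause says that [x] attains it. *)
Lemma conjugate_potential X Y (c : X -> Y -> R) (f : X -> R) :
    bounded_oscillation (fun y x => c x y) ->
    (exists y b, forall x, f x <= c x y + b) -> inhabited X ->
  exists g : Y -> R, [/\ cost_regular (fun y x => c x y) g,
    forall x y, f x + g y <= c x y &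
    forall x y, (forall z, f z + c x y <= f x + c z y) -> f x + g y = c x y].
Proof.
move=> osc [y0 [b0 fb]] [x0].
have [|y|g [greg gle leg]] :=
    @cost_infimum _ _ (fun y x => c x y) [set xb | xb.2 = - f xb.1].
- by exists (x0, - f x0).
- have [D hD] := osc y y0.
  exists (- D - b0) => _ [[x b]/= -> <-].
  by have := hD x; have := fb x; lra.
have fg x y : f x + g y <= c x y by have := gle y x (- f x) erefl; lra.
exists g; split => // x y xy; apply/eqP; rewrite eq_le fg/= addrC -lerBlDr.
by apply: leg => z _ /= ->; have := xy z; lra.
Qed.

End potentials.

(** The inequality at [p (ordS i)] with [z] the first component of [p i] is summed over the cycle:
    the values of [f] cancel and the diagonal costs are only reindexed. *)
Lemma potential_monotone (R : realType) X Y (c : X -> Y -> R) (f : X -> R)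
    (A : set (X * Y)) :
    (forall a z, A a -> f z + c a.1 a.2 <= f a.1 + c z a.2) ->
  cyclically_monotone c A.
Proof.
move=> fA k p _ Ap; pose h i := f (p i).1.
have hS : \sum_i h (ordS i) = \sum_i h i.
  by rewrite [RHS](reindex_inj (@ordS_inj _)).
rewrite -(lerD2l (\sum_i h i)) -{2}hS -!big_split/= [leLHS](_ : _ =
  \sum_i (h i + c (p (ordS i)).1 (p (ordS i)).2)).
  by apply: ler_sum => i _; exact/fA/Ap.
rewrite !big_split/=; congr (_ + _).
exact: (reindex_inj (@ordS_inj _)).
Qed.

(** * Logarithmic coordinates on the orthant *)

Section log_coordinates.
Context (R : realType) (m : nat).
Local Notation V := (posvec R m).
Implicit Types (x y : V) (f : V -> R).

(* Instance resolution unfolds the neighbourhoods of the subtype topology. *)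
#[local] Instance posvec_nbhs_filter (x : V) : ProperFilter (nbhs x).
Proof. exact: nbhs_pfilter. Qed.

Definition log_coord (x : V) (i : 'I_m) : R := ln (set_val x ord0 i).

Lemma posvec_gt0 x i : 0 < set_val x ord0 i.
Proof. by have := set_valP x; apply. Qed.

Lemma posvecE x i : set_val x ord0 i = expR (log_coord x i).
Proof. by rewrite lnK// posrE posvec_gt0. Qed.

(** [D] may have either sign, so besides being 1-Lipschitz for the sup distance [f] is monotone and
    satisfies f(t x) = ln t + f(x). *)
Definition log_lipschitz f := forall x x' D,
  (forall i, log_coord x' i <= log_coord x i + D) -> f x' <= f x + D.

Lemma continuous_log_coord i : continuous (log_coord^~ i).
Proof.
move=> x; apply: (@continuous_comp _ _ _ (fun x : V => set_val x ord0 i) (@ln R)).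
  apply: (@continuous_comp _ _ _ (set_val : V -> 'rV[R]_m) (fun M => M ord0 i)).
    exact: initial_continuous.
  exact: coord_continuous.
exact/continuous_ln/posvec_gt0.
Qed.

Lemma continuous_measurable_posvec f : continuous f -> measurable_fun setT f.
Proof.
move=> /continuousP cf; apply: (measurability _ (RGenOpens.measurableE R)).
move=> _ [_ [a [b ->] <-]]; rewrite setTI; apply: sub_sigma_algebra.
exact/cf/interval_open.
Qed.

Lemma measurable_log_coord i : measurable_fun setT (log_coord^~ i).
Proof. by apply: continuous_measurable_posvec; exact: continuous_log_coord. Qed.

(** The potentials are infima over possibly uncountable families, so their measurability comes from
    continuity. *)
Lemma log_lipschitz_measurable f : log_lipschitz f -> measurable_fun setT f.
Proof.
move=> lf; apply: continuous_measurable_posvec => x.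
apply/cvgrPdist_le => e e0.
have : \forall x' \near x, forall i, `|log_coord x i - log_coord x' i| <= e.
  apply: (@filter_forall _ _ _ (nbhs x)) => i.
  exact: ((@cvgrPdist_le _ _ _ _ _ _ _).1 (@continuous_log_coord i x)).
apply: filterS => x' xx'.
have h1 : f x <= f x' + e.
  by apply: lf => i; have := xx' i; rewrite ler_norml; lra.
have h2 : f x' <= f x + e.
  by apply: lf => i; have := xx' i; rewrite ler_norml; lra.
by rewrite ler_norml; lra.
Qed.

Lemma log_coord_scale (t : R) (t0 : 0 < t) x i :
  log_coord (pscale t0 x) i = ln t + log_coord x i.
Proof. by rewrite /log_coord /= mxE lnM// posrE ?posvec_gt0. Qed.

(** Its square replaces the compact set: being a product, it carries every coupling of the
    marginals, and the cost is bounded on it. *)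
Definition log_box (M : R) : set V := [set x | forall i, `|log_coord x i| <= M].

Lemma measurable_log_box M : measurable (log_box M).
Proof.
rewrite (_ : log_box M = \bigcap_(i in [set: 'I_m])
    (log_coord^~ i @^-1` [set` `[- M, M]])).
  apply: fin_bigcap_measurable => [|i _]; first exact: finite_finset.
  rewrite -[X in measurable X]setTI.
  by apply: measurable_log_coord => //; exact: measurable_itv.
apply/seteqP; split => x /= xM i; first by rewrite /= in_itv/= -ler_norml.
by have := xM i I; rewrite /= in_itv/= -ler_norml.
Qed.

(** The origin of the logarithmic coordinates. *)
Definition ones : V := exist _ (const_mx 1) (const1_pos_orthant R m).

Lemma log_coord1 i : log_coord ones i = 0.
Proof. by rewrite /log_coord/= mxE ln1. Qed.

Lemma log_lipschitz_box f M x : log_lipschitz f -> log_box M x ->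
  `|f x| <= `|f ones| + M.
Proof.
move=> lf xM.
have h1 : f x <= f ones + M.
  by apply: lf => i; rewrite log_coord1; have := xM i; rewrite ler_norml; lra.
have h2 : f ones <= f x + M.
  by apply: lf => i; rewrite log_coord1; have := xM i; rewrite ler_norml; lra.
rewrite ler_norml; have := ler_norm (f ones); have := ler_norm (- f ones).
by rewrite normrN; lra.
Qed.

Lemma dotpC x y : dotp x y = dotp y x.
Proof. by apply: eq_bigr => i _; rewrite mulrC. Qed.

Lemma log_costC x y : log_cost x y = log_cost y x.
Proof. by rewrite /log_cost dotpC. Qed.

Lemma measurable_log_cost :
  measurable_fun [set: V * V] (fun z => log_cost z.1 z.2).
Proof.
have mcoord i (g : V * V -> V) : measurable_fun setT g ->
    measurable_fun setT (fun z => set_val (g z) ord0 i).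
  move=> mg; under eq_fun do rewrite posvecE.
  exact: (measurableT_comp (@measurable_expR R)
    (measurableT_comp (measurable_log_coord i) mg)).
apply: (measurableT_comp (@measurable_ln R)).
apply: measurable_sum => i; apply: measurable_funM; apply: mcoord.
  exact: measurable_fst.
exact: measurable_snd.
Qed.

Hypothesis m_ge1 : (1 <= m)%N.

Lemma dotp_gt0 x y : 0 < dotp x y.
Proof.
rewrite /dotp (bigD1 (Ordinal m_ge1))//= ltr_pwDl ?mulr_gt0 ?posvec_gt0//.
by rewrite sumr_ge0// => i _; rewrite mulr_ge0// ltW// posvec_gt0.
Qed.

(** If each coordinate of [x'] is at most exp(D) times that of [x], the same holds for the scalar
    products with the positive vector [y]. *)
Lemma log_cost_lipschitz y : log_lipschitz (fun x => log_cost x y).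
Proof.
move=> x x' D xx'; rewrite /log_cost -[leLHS]expRK// -[leRHS]expRK//.
rewrite ler_ln ?posrE ?expR_gt0// expRD !lnK ?posrE ?dotp_gt0//.
rewrite /dotp mulr_suml ler_sum// => i _.
rewrite mulrAC ler_pM2r ?posvec_gt0// !posvecE -expRD ler_expR.
exact: xx'.
Qed.

Lemma cost_regular_log_lipschitz f :
  cost_regular (@log_cost R m) f -> log_lipschitz f.
Proof.
by move=> rf x x' D xx'; apply: rf => y; exact: log_cost_lipschitz.
Qed.

Lemma log_cost_oscillation : bounded_oscillation (@log_cost R m).
Proof.
move=> x x'; exists (\sum_i `|log_coord x' i - log_coord x i|) => y.
apply: log_cost_lipschitz => i; rewrite addrC -lerBlDr (le_trans (ler_norm _))//.
by rewrite (bigD1 i)//= lerDl sumr_ge0.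
Qed.

Lemma log_cost_scale (t : R) (t0 : 0 < t) x y :
  log_cost (pscale t0 x) y = ln t + log_cost x y.
Proof.
apply/eqP; rewrite eq_le addrC log_cost_lipschitz/=; last first.
  by move=> i; rewrite log_coord_scale addrC.
rewrite -lerBrDr; apply: log_cost_lipschitz => i; rewrite log_coord_scale.
lra.
Qed.

Lemma log_cost_box M x y : log_box M x -> log_box M y ->
  `|log_cost x y| <= `|log_cost ones ones| + M + M.
Proof.
move=> xM yM; rewrite (le_trans (log_lipschitz_box (@log_cost_lipschitz y) xM))//.
rewrite lerD2r log_costC.
exact: (log_lipschitz_box (@log_cost_lipschitz ones) yM).
Qed.

End log_coordinates.

(** * Compact sets: measurability and enclosing boxes *)

Section compact_sets.
Context (R : realType) (m : nat).
Local Notation V := (posvec R m).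

Lemma posvec_eq (x y : V) :
  (forall i, log_coord x i = log_coord y i) -> x = y.
Proof.
move=> xy; apply/val_inj/rowP => i; move: (xy i) => /(congr1 expR).
by rewrite -!posvecE.
Qed.

(** The logarithmic coordinates of both factors are continuous real functions that together separate
    points. *)
Lemma posvec_prod_hausdorff : hausdorff_space (V * V)%type.
Proof.
suff sep (g : V * V -> V) : continuous g -> forall p q : V * V,
    cluster (nbhs p) q -> g p = g q.
  move=> [p1 p2] [q1 q2] pq; congr (_, _).
    by apply: (sep fst _ _ _ pq) => z; exact: cvg_fst.
  by apply: (sep snd _ _ _ pq) => z; exact: cvg_snd.
move=> cg p q pq; apply: posvec_eq => i; apply: (@Rhausdorff R) => A B pA qB.
have ch : continuous (fun z => log_coord (g z) i).
  move=> z; apply: (@continuous_comp _ _ _ g (fun x => log_coord x i)).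
    exact: cg.
  exact: continuous_log_coord.
by have [z [Az Bz]] := pq _ _ (ch p A pA) (ch q B qB); exists (log_coord (g z) i).
Qed.

Lemma compact_measurable_posvec (K : set (V * V)) : compact K -> measurable K.
Proof.
move=> /(compact_closed posvec_prod_hausdorff)/closed_openC oK.
rewrite -[K]setCK; apply: measurableC.
by rewrite posvec_prod_borelE; exact: sub_sigma_algebra.
Qed.

Lemma compact_log_box (K : set (V * V)) : compact K ->
  exists M, K `<=` log_box M `*` log_box M.
Proof.
move=> cK.
have bnd (g : V * V -> V) : continuous g ->
    exists M, forall z, K z -> log_box M (g z).
  move=> cg.
  have /choice[M hM] (i : 'I_m) :
      exists M, forall z, K z -> `|log_coord (g z) i| <= M.
    have : compact ((fun z => log_coord (g z) i : R^o) @` K).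
      apply: continuous_compact => //; apply: continuous_subspaceT => z.
      apply: (@continuous_comp _ _ _ g (fun x => log_coord x i)).
        exact: cg.
      exact: continuous_log_coord.
    move=> /compact_bounded[N [_ hN]]; exists (N + 1) => z Kz.
    by apply: hN; [rewrite ltrDl|exists z].
  exists (\sum_i `|M i|) => z Kz i; rewrite (le_trans (hM i z Kz))//.
  by rewrite (bigD1 i)//= (le_trans (ler_norm _))// lerDl sumr_ge0.
have [M1 h1] : exists M, forall z, K z -> log_box M z.1.
  by apply: (bnd fst) => z; exact: cvg_fst.
have [M2 h2] : exists M, forall z, K z -> log_box M z.2.
  by apply: (bnd snd) => z; exact: cvg_snd.
exists (Num.max M1 M2) => z Kz; split => i.
  by rewrite le_max h1.
by rewrite le_max h2// orbT.
Qed.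

End compact_sets.

(** * Integration against a probability carried by a set *)

Section full_sets.
Context d (T : measurableType d) (R : realType) (Q : probability T R).
Context (S : set T).
Hypotheses (mS : measurable S) (QS : Q S = 1%E).

Let QSC : Q (~` S) = 0%E.
Proof. by rewrite probability_setC// QS subee. Qed.

(** The cost and the potentials are unbounded on the whole orthant; a bound on a set of full measure
    is enough for their integrals. *)
Definition bounded_on (f : T -> R) :=
  exists C : R, forall z, S z -> `|f z| <= C.

Lemma full_set_integral_abs (f : T -> R) : measurable_fun setT f ->
  (\int[Q]_z `|(f z)%:E| = \int[Q]_(z in S) `|(f z)%:E|)%E.
Proof.
move=> mf; rewrite (ge0_negligible_integral (measurableC mS))//.
  by rewrite setTD setCK.
by apply: measurableT_comp => //; exact/measurable_EFinP.
Qed.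

Lemma full_set_integrable (f : T -> R) : measurable_fun setT f ->
  bounded_on f -> Q.-integrable setT (EFin \o f).
Proof.
move=> mf [C fC]; apply/integrableP; split; first exact/measurable_EFinP.
rewrite full_set_integral_abs//.
apply: (@le_lt_trans _ _ (C%:E * Q S)%E); last by rewrite QS mule1 ltry.
rewrite -integral_cst//; apply: ge0_le_integral => //.
apply: measurable_funTS; apply: measurableT_comp => //.
exact/measurable_EFinP.
Qed.

Lemma full_set_Rintegral (f : T -> R) : measurable_fun setT f ->
  bounded_on f -> \int[Q]_z f z = \int[Q]_(z in S) f z.
Proof.
move=> mf bf; congr fine; rewrite (negligible_integral (measurableC mS) _ _ QSC)//.
  by rewrite setTD setCK.
exact: full_set_integrable.
Qed.

Lemma full_set_le_Rintegral (f g : T -> R) : measurable_fun setT f ->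
  measurable_fun setT g -> bounded_on f -> bounded_on g ->
  (forall z, S z -> f z <= g z) -> \int[Q]_z f z <= \int[Q]_z g z.
Proof.
move=> mf mg bf bg fg; rewrite !full_set_Rintegral// le_Rintegral//;
  by apply: (@integrableS _ _ _ _ setT) => //; exact: full_set_integrable.
Qed.

Lemma probability_Rintegral_cst (C : R) : \int[Q]_z C = C.
Proof.
rewrite Rintegral_cst// -[RHS]mulr1.
exact: (congr1 (fun e => C * fine e) (probability_setT Q)).
Qed.

Lemma full_set_Rintegral_le (f : T -> R) C : measurable_fun setT f ->
  bounded_on f -> (forall z, S z -> f z <= C) -> \int[Q]_z f z <= C.
Proof.
move=> mf bf fC; have -> : C = \int[Q]_z C.
  by rewrite probability_Rintegral_cst.
by apply: full_set_le_Rintegral => //; exists `|C|.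
Qed.

Lemma full_set_Rintegral_ge (f : T -> R) C : measurable_fun setT f ->
  bounded_on f -> (forall z, S z -> C <= f z) -> C <= \int[Q]_z f z.
Proof.
move=> mf bf fC; have -> : C = \int[Q]_z C.
  by rewrite probability_Rintegral_cst.
by apply: full_set_le_Rintegral => //; exists `|C|.
Qed.

Lemma full_set_integralE (f : T -> R) : measurable_fun setT f ->
  bounded_on f -> (\int[Q]_z (f z)%:E = (\int[Q]_z f z)%:E)%E.
Proof.
move=> mf bf; rewrite /Rintegral fineK//.
exact: integrable_fin_num (full_set_integrable mf bf).
Qed.

End full_sets.

(** * Couplings *)

Section couplings.
Context d1 d2 (X : measurableType d1) (Y : measurableType d2) (R : realType).
Context (mu : probability X R) (nu : probability Y R).
Implicit Types Q : probability (X * Y)%type R.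

Lemma probability1_le d (T : measurableType d) (Q : probability T R) A B :
  measurable A -> measurable B -> A `<=` B -> Q A = 1%E -> Q B = 1%E.
Proof.
move=> mA mB AB QA; apply/eqP; rewrite eq_le probability_le1//= -QA.
by apply: le_measure => //; rewrite inE.
Qed.

Lemma probability1I d (T : measurableType d) (Q : probability T R) A B :
  measurable A -> measurable B -> Q A = 1%E -> Q B = 1%E -> Q (A `&` B) = 1%E.
Proof.
move=> mA mB QA QB; have mAB := measurableI _ _ mA mB.
have null E : measurable E -> Q E = 1%E -> Q.-negligible (~` E).
  move=> mE QE; apply/negligibleP; first exact: measurableC.
  have QE0 : Q (~` E) = 0%E by rewrite probability_setC// QE subee.
  exact: QE0.
have := measure_negligible _ (negligibleU (null _ mA QA) (null _ mB QB)).
rewrite -setCI => /(_ (measurableC mAB)) QC.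
have := probability_setC Q (measurableC mAB).
by rewrite setCK => ->; rewrite [X in (_ - X)%E]QC sube0.
Qed.

(** The marginals make the cylinders over [A] and [B] full, hence also their intersection. *)
Lemma coupling_prod1 Q A B : coupling mu nu Q -> measurable A -> measurable B ->
  mu A = 1%E -> nu B = 1%E -> Q (A `*` B) = 1%E.
Proof.
move=> [Q1 Q2] mA mB muA nuB.
rewrite (_ : A `*` B = (fst @^-1` A) `&` (snd @^-1` B)); last by [].
apply: probability1I.
- by rewrite -[X in measurable X]setTI; exact: measurable_fst.
- by rewrite -[X in measurable X]setTI; exact: measurable_snd.
- by rewrite -muA -Q1.
- by rewrite -nuB -Q2.
Qed.

(** A separated integrand sees only the marginals; this lets the dual value be compared across
    couplings. *)
Lemma coupling_Rintegral Q A B (f : X -> R) (g : Y -> R) :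
    coupling mu nu Q -> measurable A -> measurable B ->
    mu A = 1%E -> nu B = 1%E -> measurable_fun setT f -> measurable_fun setT g ->
    bounded_on A f -> bounded_on B g ->
  \int[Q]_z (f z.1 + g z.2) = \int[mu]_x f x + \int[nu]_y g y.
Proof.
move=> cQ mA mB muA nuB mf mg [C fC] [D gD].
have QAB := coupling_prod1 cQ mA mB muA nuB.
have mAB := measurableX mA mB.
have if1 : Q.-integrable setT (EFin \o (f \o fst)).
  apply: (full_set_integrable mAB QAB); first exact: measurableT_comp.
  by exists C => z [/fC].
have ig1 : Q.-integrable setT (EFin \o (g \o snd)).
  apply: (full_set_integrable mAB QAB); first exact: measurableT_comp.
  by exists D => z [_ /gD].
rewrite RintegralD//; congr (_ + _); rewrite /Rintegral; congr fine.
  transitivity (\int[pushforward Q fst]_x (f x)%:E)%E.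
    by rewrite integral_pushforward//; exact/measurable_EFinP.
  by apply: eq_measure_integral => E mE _; exact: cQ.1.
transitivity (\int[pushforward Q snd]_y (g y)%:E)%E.
  by rewrite integral_pushforward//; exact/measurable_EFinP.
by apply: eq_measure_integral => E mE _; exact: cQ.2.
Qed.

End couplings.

(** * Weighted sums, normalisation and conditioning of measures *)

Section measure_constructions.
Context d (T : measurableType d) (R : realType).
Implicit Types P Q : probability T R.

Lemma weighted_measure_sum (I : Type) (s : seq I) (w : I -> {nonneg R})
    (m : I -> {measure set T -> \bar R}) :
  exists M : {measure set T -> \bar R},
    (forall A, M A = \sum_(i <- s) (w i)%:num%:E * m i A)%E /\
    forall h : T -> \bar R, measurable_fun setT h -> (forall z, (0 <= h z)%E) ->
      (\int[M]_z h z = \sum_(i <- s) (w i)%:num%:E * \int[m i]_z h z)%E.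
Proof.
elim: s => [|i s [M [MA Mh]]].
  exists mzero; split=> [A|h mh h0]; rewrite big_nil//.
  exact: integral_measure_zero.
exists (measure_add (mscale (w i) (m i)) M); split=> [A|h mh h0].
  by rewrite big_cons -MA; exact: measure_addE.
by rewrite big_cons ge0_integral_measure_add// ge0_integral_mscale// Mh.
Qed.

Lemma measure_to_probability (M : {measure set T -> \bar R}) P (r : R) :
  (0 < r)%R -> M setT = r%:E -> exists Q, forall A, (r%:E * Q A = M A)%E.
Proof.
(* [P] is the fallback value of [mnormalize] for total mass zero or infinity, which [r0] and [MT]
   exclude. *)
move=> r0 MT; exists (mnormalize M P) => A; rewrite /= /mnormalize MT/=.
rewrite eqe gt_eqF//= muleCA -EFinM divff ?mule1//.
by rewrite gt_eqF.
Qed.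

(** The product form avoids division in the extended reals. *)
Lemma conditional_probability P (Z : set T) : measurable Z -> (0 < P Z)%E ->
  exists Q, forall A, (P Z * Q A = P (A `&` Z))%E.
Proof.
move=> mZ PZ; have PZfin : P Z \is a fin_num by rewrite fin_num_measure.
have [||Q QE] := @measure_to_probability (mrestr P mZ) P (fine (P Z)).
- by rewrite fine_gt0// PZ ltey_eq PZfin.
- by rewrite /= /mrestr setTI fineK.
by exists Q => A; rewrite -[X in (X * _)%E](fineK PZfin) QE.
Qed.

End measure_constructions.

Lemma image_probability d d' (T : measurableType d) (T' : measurableType d')
    (R : realType) (f : T -> T') (P : probability T R) :
  measurable_fun setT f -> exists Q : probability T' R, forall A,
  Q A = P (f @^-1` A).
Proof.
move=> mf; pose g : {mfun T >-> T'} := mfun_Sub (mem_set mf).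
by exists (distribution P g).
Qed.

(** * Recoupling mass along a cycle of sets *)

Section competitor.
Context d1 d2 (X : measurableType d1) (Y : measurableType d2) (R : realType).
Context (mu : probability X R) (nu : probability Y R).
Context (P : probability (X * Y)%type R) (n : nat).
Context (Z : 'I_n.+1 -> set (X * Y)).
Hypotheses (P_coupling : coupling mu nu P) (mZ : forall i, measurable (Z i))
  (PZ : forall i, (0 < P (Z i))%E).

Let fineE (Q : probability (X * Y)%type R) A : measurable A ->
  Q A = (fine (Q A))%:E.
Proof. by move=> mA; rewrite fineK// fin_num_measure. Qed.

(* A little of the mass that [P] puts on each [Z i] is recoupled: the first
   marginal of [P] conditioned on [Z i] is paired, independently, with the
   second marginal of [P] conditioned on the next set. *)
Lemma competitor : exists (Q : probability (X * Y)%type R)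
    (C D : 'I_n.+1 -> probability (X * Y)%type R) (k : {nonneg R}),
  [/\ 0 < k%:num, coupling mu nu Q, forall i, C i (Z i) = 1%E,
      forall i A B, measurable A -> measurable B ->
        (D i (A `*` B) = C i (A `*` setT) * C (ordS i) (setT `*` B))%E &
      forall h : X * Y -> \bar R, measurable_fun setT h ->
        (forall z, (0 <= h z)%E) ->
        (\int[Q]_z h z + k%:num%:E * \sum_i \int[C i]_z h z =
         \int[P]_z h z + k%:num%:E * \sum_i \int[D i]_z h z)%E].
Proof.
have /choice[C CE] i := conditional_probability (mZ i) (PZ i).
have CZ i : C i (Z i) = 1%E.
  have /eqP := CE i (Z i); rewrite setIid => /eqP.
  rewrite (fineE P (mZ i)) (fineE (C i) (mZ i)) -EFinM => -[].
  have p0 : fine (P (Z i)) != 0 by rewrite fine_eq0 ?fin_num_measure// gt_eqF.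
  by move=> /(canRL (mulKf p0)); rewrite mulVf// => ->.
have /choice[C1 C1E] i := image_probability (C i) (@measurable_fst _ _ X Y).
have /choice[C2 C2E] i := image_probability (C i) (@measurable_snd _ _ X Y).
pose D i : probability (X * Y)%type R := (C1 i \x C2 (ordS i))%E.
have DE i A B : measurable A -> measurable B ->
    (D i (A `*` B) = C i (A `*` setT) * C (ordS i) (setT `*` B))%E.
  move=> mA mB; transitivity (C1 i A * C2 (ordS i) B)%E.
    exact: product_measure1E.
  rewrite C1E C2E.
  congr (C i _ * C _ _)%E.
  - by apply/seteqP; split => // -[x y] [].
  - by apply/seteqP; split => // -[x y] [].
pose p i := fine (P (Z i)).
have p_gt0 i : 0 < p i by rewrite fine_gt0// PZ ltey_eq fin_num_measure.
(* With [l] at most every [p i], removing the mass [l] from [Z i] leaves the nonnegative weight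
   [1 - l / p i] there. *)
pose l := \big[Order.min/1]_i p i.
have l_gt0 : 0 < l by apply: lt_bigmin.
have l_le i : l <= p i by apply: ge_bigmin_seq => //; exact: mem_index_enum.
have b_ge0 i : 0 <= 1 - l / p i.
  by rewrite subr_ge0 ler_pdivrMr// mul1r.
(* This is [P] minus [l] times [C i] plus [l] times [D i], written without subtraction so that it is
   visibly a measure. *)
pose Q_ i : {measure set (X * Y) -> \bar R} :=
  measure_add (mrestr P (measurableC (mZ i)))
    (measure_add (mscale (NngNum (b_ge0 i)) (mrestr P (mZ i)))
                 (mscale (NngNum (ltW l_gt0)) (D i))).
have Q_E i A : measurable A ->
    Q_ i A = (fine (P A) - l * fine (C i A) + l * fine (D i A))%:E.
  move=> mA; have mAZ := measurableI _ _ mA (mZ i).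
  have mAC := measurableI _ _ mA (measurableC (mZ i)).
  transitivity (P (A `&` ~` Z i) + ((1 - l / p i)%:E * P (A `&` Z i) + l%:E * D i A))%E.
    apply: etrans (measure_addE _ _ _) _; congr (_ + _)%E.
    exact: measure_addE.
  have PA : fine (P A) = fine (P (A `&` Z i)) + fine (P (A `&` ~` Z i)).
    rewrite -fineD ?fin_num_measure// -measureU//.
      by rewrite -setIUr setUv setIT.
    by rewrite setIACA setICr setI0.
  have PC : fine (P (A `&` Z i)) = p i * fine (C i A).
    by rewrite -CE (fineE P (mZ i)) (fineE (C i) mA) -EFinM.
  rewrite (fineE P mAC) (fineE P mAZ) (fineE (D i) mA) -!EFinM -!EFinD PA PC.
  congr EFin; have := p_gt0 i; move: (p i) => q q0.
  have /[dup] qq : l / q * q = l by rewrite divfK// gt_eqF.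
  move: (l / q) => r; move: (fine _) => a; nra.
have n_ge0 : 0 <= (n.+1%:R^-1 : R) by [].
(* The sets [Z i] may overlap, so each exchange is made in its own copy of [P] and the copies are
   averaged; the second marginals balance only in the average. *)
have [M [MA Mh]] := weighted_measure_sum (index_enum 'I_n.+1)
  (fun=> NngNum n_ge0) Q_.
pose k := l / n.+1%:R.
have k0 : 0 <= k by rewrite divr_ge0// ltW.
have ME A : measurable A -> M A = (fine (P A) - k * \sum_i fine (C i A)
    + k * \sum_i fine (D i A))%:E.
  move=> mA; rewrite MA; under eq_bigr do rewrite Q_E// -EFinM.
  rewrite sumEFin -mulr_sumr !big_split/= sumrN -!mulr_sumr sumr_const card_ord.
  have N0 : n.+1%:R != 0 :> R by rewrite pnatr_eq0.
  rewrite -[fine _ *+ _]mulr_natl /k/=.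
  by congr EFin; move: n.+1%:R N0 => N N0; field.
have fineT (Q : probability (X * Y)%type R) : fine (Q setT) = 1.
  exact: (congr1 fine (probability_setT Q)).
have [//||Q QE] := @measure_to_probability _ _ _ M P 1.
  by rewrite ME// fineT; under eq_bigr do rewrite fineT;
     under [in X in _ + X]eq_bigr do rewrite fineT; rewrite subrK.
have {}QE A : Q A = M A by rewrite -[LHS]mul1e QE.
exists Q, C, D, (NngNum k0); split => //=.
- by rewrite divr_gt0.
- split=> [A mA|B mB].
    have mAT : measurable (A `*` [set: Y]) by exact: measurableX.
    rewrite -P_coupling.1// /pushforward.
    rewrite (_ : fst @^-1` A = A `*` setT); last first.
      by apply/seteqP; split => // -[x y] [].
    rewrite QE ME// [X in _ + k * X](eq_bigr (fun i => fine (C i (A `*` setT)))) => [|i _].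
      by rewrite subrK fineK// fin_num_measure.
    by rewrite DE// setXTT [X in (_ * X)%E]probability_setT mule1.
  have mTB : measurable ([set: X] `*` B) by exact: measurableX.
  rewrite -P_coupling.2// /pushforward.
  rewrite (_ : snd @^-1` B = setT `*` B); last first.
    by apply/seteqP; split => // -[x y] [].
  (* The second marginal of [D i] is that of [C (ordS i)], so after a cyclic shift the removed and
     added masses agree. *)
  rewrite QE ME// [X in _ - k * X](reindex_inj (@ordS_inj _))/=.
  rewrite [X in _ + k * X](eq_bigr (fun i => fine (C (ordS i) (setT `*` B)))) => [|i _].
    by rewrite subrK fineK// fin_num_measure.
  by rewrite DE// setXTT [X in (X * _)%E]probability_setT mul1e.
- move=> h mh h0.
  have sumC (F : 'I_n.+1 -> probability (X * Y)%type R) :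
      exists N : {measure set (X * Y) -> \bar R},
        (forall A, N A = \sum_i F i A)%E /\
        (\int[N]_z h z = \sum_i \int[F i]_z h z)%E.
    have [N [NA Nh]] := weighted_measure_sum (index_enum 'I_n.+1)
      (fun=> 1%:nng) (fun i => F i).
    exists N; split=> [A|]; rewrite ?NA ?Nh//;
      by apply: eq_bigr => i _; rewrite mul1e.
  have [NC [NCA NCh]] := sumC C; have [ND [NDA NDh]] := sumC D.
  rewrite -NCh -NDh.
  rewrite -(ge0_integral_mscale NC measurableT (NngNum k0) mh)//.
  rewrite -(ge0_integral_mscale ND measurableT (NngNum k0) mh)//.
  (* With the removed mass moved to the left side, the claim becomes an equality of two measures. *)
  rewrite -!ge0_integral_measure_add//; apply: eq_measure_integral => A mA _.
  transitivity (Q A + k%:E * NC A)%E; first exact: measure_addE.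
  transitivity (P A + k%:E * ND A)%E; last exact/esym/measure_addE.
  have sumE (F : 'I_n.+1 -> probability (X * Y)%type R) :
      (\sum_i F i A)%E = (\sum_i fine (F i A))%:E.
    by rewrite -sumEFin; apply: eq_bigr => i _; exact: fineE.
  rewrite QE ME// NCA NDA !sumE [in RHS](fineE P mA) -!EFinM -!EFinD.
  by congr EFin; lra.
Qed.

End competitor.

(** * Grids in logarithmic coordinates *)

Section grid.
Context (R : realType) (m : nat) (M : R).
Local Notation V := (posvec R m).

(** Half-open cubes of side [N.+1%:R^-1] in logarithmic coordinates, cut to the box; integer indices
    keep the cells of all meshes countable. *)
Definition grid_cell (N : nat) (a : {ffun 'I_m -> int}) : set V :=
  log_box M `&` [set x | forall i,
    (a i)%:~R <= N.+1%:R * log_coord x i < (a i + 1)%:~R].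

Lemma measurable_grid_cell N a : measurable (grid_cell N a).
Proof.
apply: measurableI; first exact: measurable_log_box.
rewrite (_ : [set x | _] = \bigcap_(i in [set: 'I_m])
    ((fun x => N.+1%:R * log_coord x i) @^-1`
      [set` `[(a i)%:~R : R, (a i + 1)%:~R[])).
  apply: fin_bigcap_measurable => [|i _]; first exact: finite_finset.
  rewrite -[X in measurable X]setTI.
  have mi : measurable_fun setT (fun x : V => N.+1%:R * log_coord x i).
    by apply: measurable_funM => //; exact: measurable_log_coord.
  by apply: mi => //; exact: measurable_itv.
apply/seteqP; split => x /= xa i; first by rewrite /= in_itv/=.
by have := xa i I; rewrite /= in_itv/=.
Qed.

Lemma in_grid_cell N x : log_box M x -> exists a, grid_cell N a x.
Proof.
move=> xM; exists [ffun i => Num.floor (N.+1%:R * log_coord x i)].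
by split=> // i; rewrite ffunE floor_itv.
Qed.

Lemma grid_cell_dist N a x x' i : grid_cell N a x -> grid_cell N a x' ->
  log_coord x i <= log_coord x' i + N.+1%:R^-1.
Proof.
move=> [_ /(_ i)/andP[_ h1]] [_ /(_ i)/andP[h2 _]].
have N0 : 0 < N.+1%:R :> R by [].
rewrite -(ler_pM2l N0) mulrDr mulfV ?gt_eqF//.
by move: h1; rewrite intrD; lra.
Qed.

Lemma log_cost_grid N a b x y x' y' : (1 <= m)%N ->
  grid_cell N a x -> grid_cell N b y -> grid_cell N a x' -> grid_cell N b y' ->
  log_cost x y <= log_cost x' y' + 2 / N.+1%:R.
Proof.
move=> m1 xa yb x'a y'b.
have h1 : log_cost x y <= log_cost x' y + N.+1%:R^-1.
  by apply: log_cost_lipschitz => // i; exact: grid_cell_dist xa x'a.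
have h2 : log_cost y x' <= log_cost y' x' + N.+1%:R^-1.
  by apply: log_cost_lipschitz => // i; exact: grid_cell_dist yb y'b.
rewrite (log_costC x') in h1; rewrite (log_costC x').
by move: h1 h2; move: N.+1%:R^-1 => d; lra.
Qed.

(* The part of the box covered by no null cell plays the role of the support. *)
Lemma grid_support (P : probability (V * V)%type R) :
    P (log_box M `*` log_box M) = 1%E ->
  exists G : set (V * V), [/\ measurable G, P G = 1%E,
    G `<=` log_box M `*` log_box M &
    forall N z, G z -> exists a b, [/\ grid_cell N a z.1, grid_cell N b z.2 &
      (0 < P (grid_cell N a `*` grid_cell N b))%E]].
Proof.
move=> PB; pose cell (k : nat * ({ffun 'I_m -> int} * {ffun 'I_m -> int})) :=
  grid_cell k.1 k.2.1 `*` grid_cell k.1 k.2.2.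
have mcell k : measurable (cell k).
  by apply: measurableX; exact: measurable_grid_cell.
(* An enumeration of the null product cells of all meshes, padded with the empty set. *)
pose F n := if unpickle n is Some k then
  if P (cell k) == 0%E then cell k else set0 else set0.
have mF n : measurable (F n).
  by rewrite /F; case: unpickle => // k; case: ifPn.
have PF n : P.-negligible (F n).
  apply/negligibleP; first exact: mF.
  by rewrite /F; case: unpickle => [k|]; rewrite ?measure0//; case: ifPn => [/eqP|].
have mUF : measurable (\bigcup_n F n) by exact: bigcupT_measurable.
have mB : measurable (log_box M `*` log_box M : set (V * V)).
  by apply: measurableX; exact: measurable_log_box.
have PUF : P (~` \bigcup_n F n) = 1%E.
  rewrite probability_setC// (_ : P _ = 0%E) ?sube0//.
  exact: measure_negligible (negligible_bigcup _).
exists ((log_box M `*` log_box M) `&` ~` (\bigcup_n F n)); split.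
- exact: measurableI (measurableC _).
- exact: probability1I (measurableC _) _ _.
- by move=> z [].
- move=> N z [[z1 z2] Fz].
  have [a za] := in_grid_cell N z1; have [b zb] := in_grid_cell N z2.
  exists a, b; split=> //; rewrite lt0e measure_ge0 andbT.
  apply/eqP => P0; apply: Fz; exists (pickle (N, (a, b))) => //.
  by rewrite /F pickleK /cell/= P0 eqxx.
Qed.

End grid.

(** * Optimality and cyclical monotonicity *)

Section optimality.
Context (R : realType) (m : nat) (m_ge1 : (1 <= m)%N).
Local Notation V := (posvec R m).
Context (P : probability (V * V)%type R) (mu nu : probability V R).
Context (M : R).
Local Notation B := (log_box M : set V).
Local Notation c := (@log_cost R m).
Hypotheses (P_coupling : coupling mu nu P) (PB : P (B `*` B) = 1%E).

Let mB : measurable B := measurable_log_box M.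

Lemma marginal_box : mu B = 1%E /\ nu B = 1%E.
Proof.
have mBB : measurable (B `*` B) := measurableX mB mB.
split; [rewrite -P_coupling.1//|rewrite -P_coupling.2//].
  apply: (probability1_le mBB _ _ PB) => [|z []//].
  by rewrite -[X in measurable X]setTI; exact: measurable_fst.
apply: (probability1_le mBB _ _ PB) => [|z []//].
by rewrite -[X in measurable X]setTI; exact: measurable_snd.
Qed.

Lemma coupling_box Q : coupling mu nu Q -> Q (B `*` B) = 1%E.
Proof. by move=> cQ; have [] := marginal_box; exact: coupling_prod1. Qed.

Lemma bounded_log_cost : bounded_on (B `*` B) (fun z => c z.1 z.2).
Proof.
by exists (`|c (ones R m) (ones R m)| + M + M) => z []; exact: log_cost_box.
Qed.

(** The argument is direct: on a fine enough grid, optimality against the competitor gives the cycle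
    inequality up to an arbitrary [e]. *)
Lemma optimal_cyclically_monotone : solves_MK mu nu c P ->
  exists G : set (V * V),
    [/\ measurable G, cyclically_monotone c G & P G = 1%E].
Proof.
move=> [_ optP].
have mBB : measurable (B `*` B) := measurableX mB mB.
have [W cW] := bounded_log_cost.
(* The competitor identity is for nonnegative functions: [h] is one everywhere and equals the cost
   plus [W] on the box. *)
pose h z := Num.max (c z.1 z.2 + W) 0.
have mc : measurable_fun setT (fun z : V * V => c z.1 z.2 + W).
  by apply: measurable_funD => //; exact: measurable_log_cost.
have mh : measurable_fun setT h by exact: measurable_maxr.
have hE z : (B `*` B) z -> h z = c z.1 z.2 + W.
  by move=> /cW; rewrite ler_norml /h => cz; rewrite max_l//; lra.
have bh : bounded_on (B `*` B) h.
  exists (W + W) => z Bz; rewrite hE//; have := cW z Bz.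
  by rewrite !ler_norml; lra.
have [G [mG PG GB cellG]] := grid_support PB.
exists G; split=> // n p _ Gp; apply/ler_addgt0Pr => e e0.
(* Each of the [n.+1] terms is estimated up to [2 / N.+1%:R] on both sides of the comparison, so the
   total error is at most [e]. *)
pose N := Num.bound (n.+1%:R * 4 / e).
have Ne : n.+1%:R * (4 / N.+1%:R) <= e.
  rewrite mulrA ler_pdivrMr// -ler_pdivrMl// mulrC.
  rewrite (le_trans (ltW (archi_boundP _))) ?ler_nat//.
  by rewrite divr_ge0// ltW.
have /choice[a /choice[b ab]] i := cellG N (p i) (Gp i).
pose Z i := grid_cell M N (a i) `*` grid_cell M N (b i) : set (V * V).
have mcell a' : measurable (grid_cell M N a' : set V) by exact: measurable_grid_cell.
have mZ i : measurable (Z i) by exact: measurableX.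
have PZ i : (0 < P (Z i))%E by have [] := ab i.
have [Q [C [D [k [k0 cQ CZ DE eqQ]]]]] := competitor P_coupling mZ PZ.
(* [D i] takes its first component from cell [i] and its second from the next one. *)
pose Z' i := grid_cell M N (a i) `*` grid_cell M N (b (ordS i)) : set (V * V).
have mZ' i : measurable (Z' i) by exact: measurableX.
have DZ i : D i (Z' i) = 1%E.
  rewrite DE// (probability1_le (mZ i) _ _ (CZ i)); first last.
  - by move=> z [].
  - exact: measurableX.
  rewrite (probability1_le (mZ (ordS i)) _ _ (CZ (ordS i))) ?mule1//.
  - exact: measurableX.
  - by move=> z [].
have ZB i : Z i `<=` B `*` B by move=> z [[? _] [? _]].
have Z'B i : Z' i `<=` B `*` B by move=> z [[? _] [? _]].
have bZ i : bounded_on (Z i) h by have [w hw] := bh; exists w => z /ZB/hw.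
have bZ' i : bounded_on (Z' i) h by have [w hw] := bh; exists w => z /Z'B/hw.
have QB := coupling_box cQ.
have PQ : \int[P]_z h z <= \int[Q]_z h z.
  have shift (Q' : probability (V * V)%type R) : Q' (B `*` B) = 1%E ->
      \int[Q']_z h z = \int[Q']_z (c z.1 z.2) + W.
    move=> Q'B; rewrite (full_set_Rintegral mBB Q'B mh bh).
    rewrite (eq_Rintegral _ (g := fun z => c z.1 z.2 + W)) => [|z /set_mem/hE//].
    rewrite -(full_set_Rintegral mBB Q'B mc).
      rewrite RintegralD ?probability_Rintegral_cst//.
        apply: (full_set_integrable mBB Q'B _ bounded_log_cost).
        exact: measurable_log_cost.
      by apply: (full_set_integrable mBB Q'B) => //; exists `|W|.
    by have [w hw] := bh; exists w => z Bz; rewrite -hE// hw.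
  rewrite !shift// lerD2r -lee_fin.
  rewrite -!(full_set_integralE mBB _ (@measurable_log_cost R m) bounded_log_cost)//.
  exact: optP.
have := eqQ (fun z => (h z)%:E) _ _ => /(_ _ _)/wrap[||].
- exact/measurable_EFinP.
- by move=> z; rewrite lee_fin le_max lexx orbT.
rewrite (full_set_integralE mBB QB mh bh) (full_set_integralE mBB PB mh bh).
under eq_bigr do rewrite (full_set_integralE (mZ _) (CZ _) mh (bZ _)).
under [in RHS]eq_bigr do rewrite (full_set_integralE (mZ' _) (DZ _) mh (bZ' _)).
rewrite !sumEFin -!EFinM -!EFinD => -[eqR].
(* The competitor is no cheaper than [P], so the recoupled mass costs at least as much as the
   removed mass. *)
have CD : \sum_i \int[C i]_z h z <= \sum_i \int[D i]_z h z.
  by rewrite -(ler_pM2l k0); lra.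
have Cge i : c (p i).1 (p i).2 + W - 2 / N.+1%:R <= \int[C i]_z h z.
  apply: (full_set_Rintegral_ge (mZ i) (CZ i) mh (bZ i)) => z Zz.
  rewrite hE; last exact: ZB Zz.
  have [pa pb _] := ab i; have := log_cost_grid m_ge1 pa pb Zz.1 Zz.2.
  by move: (2 / _) => d; lra.
have Dle i : \int[D i]_z h z <= c (p i).1 (p (ordS i)).2 + W + 2 / N.+1%:R.
  apply: (full_set_Rintegral_le (mZ' i) (DZ i) mh (bZ' i)) => z Zz.
  rewrite hE; last exact: Z'B Zz.
  have [pa _ _] := ab i; have [_ pb _] := ab (ordS i).
  have := log_cost_grid m_ge1 Zz.1 Zz.2 pa pb.
  by move: (2 / _) => d; lra.
have := le_trans (ler_sum _ (fun i _ => Cge i)) (le_trans CD (ler_sum _ (fun i _ => Dle i))).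
rewrite -subr_ge0 -sumrB (eq_bigr (fun i =>
  (c (p i).1 (p (ordS i)).2 - c (p i).1 (p i).2) + 4 / N.+1%:R)) => [|i _].
  rewrite big_split/= sumrB sumr_const card_ord -[_ *+ n.+1]mulr_natl.
  by move: Ne; move: (n.+1%:R * _) => t; lra.
have -> : 4 / N.+1%:R = 2 / N.+1%:R + 2 / N.+1%:R :> R.
  by rewrite -mulrDl -natrD.
by move: (2 / _) => t; lra.
Qed.

(** Kantorovich duality: [f] and its conjugate [g] stay below the cost and are tight on [G]. *)
Lemma cyclically_monotone_optimal (G : set (V * V)) : measurable G ->
  cyclically_monotone c G -> P G = 1%E -> solves_MK mu nu c P.
Proof.
move=> mG cmG PG; split=> // Q cQ.
have mBB : measurable (B `*` B) := measurableX mB mB.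
have [muB nuB] := marginal_box; have QB := coupling_box cQ.
have G0 : G !=set0.
  apply/set0P/eqP => G0; move: PG; rewrite G0 measure0 => /esym/eqP.
  by rewrite onee_eq0.
have osc := @log_cost_oscillation R m m_ge1.
have [f [freg fub fG]] := monotone_potential cmG G0 osc.
have oscC : bounded_oscillation (fun y x : V => c x y).
  by move=> y y'; have [D yD] := osc y y'; exists D => x; rewrite ![c x _]log_costC.
have [g [greg fgc fgE]] := conjugate_potential oscC fub (inhabits (ones R m)).
have lf := cost_regular_log_lipschitz m_ge1 freg.
have lg : log_lipschitz g.
  apply: (cost_regular_log_lipschitz m_ge1) => y y' D yD; apply: greg => x.
  by rewrite ![c x _]log_costC.
have mf := log_lipschitz_measurable lf; have mg := log_lipschitz_measurable lg.
have bf : bounded_on B f.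
  by exists (`|f (ones R m)| + M) => x; exact: log_lipschitz_box.
have bg : bounded_on B g.
  by exists (`|g (ones R m)| + M) => x; exact: log_lipschitz_box.
have mfg : measurable_fun setT (fun z : V * V => f z.1 + g z.2).
  by apply: measurable_funD; exact: measurableT_comp.
have bfg : bounded_on (B `*` B) (fun z => f z.1 + g z.2).
  have [[C fC] [D gD]] := (bf, bg); exists (C + D) => z [/fC zC /gD zD].
  by rewrite (le_trans (ler_normD _ _))// lerD.
have mc := @measurable_log_cost R m.
rewrite (full_set_integralE mBB PB mc bounded_log_cost).
rewrite (full_set_integralE mBB QB mc bounded_log_cost) lee_fin.
(* Tightness on [G] bounds the cost of [P] by the dual value, which is the same for [Q] by equality
   of marginals and lies below the cost of [Q]. *)
apply: (@le_trans _ _ (\int[P]_z (f z.1 + g z.2))).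
  have PGB : P (G `&` (B `*` B)) = 1%E by exact: probability1I.
  apply: (full_set_le_Rintegral (measurableI _ _ mG mBB) PGB mc mfg).
  - by have [C hC] := bounded_log_cost; exists C => z [_ /hC].
  - by have [C hC] := bfg; exists C => z [_ /hC].
  - by move=> z [Gz _]; rewrite (fgE z.1 z.2) // => x; exact: fG.
rewrite (coupling_Rintegral P_coupling mB mB muB nuB mf mg bf bg).
rewrite -(coupling_Rintegral cQ mB mB muB nuB mf mg bf bg).
by apply: (full_set_le_Rintegral mBB QB mfg mc bfg bounded_log_cost) => z _.
Qed.

End optimality.

(** * Utility functions and cyclical monotonicity *)

Section utility.
Context (R : realType) (m : nat) (m_ge1 : (1 <= m)%N).
Local Notation V := (posvec R m).
Context (P : probability (V * V)%type R).
Local Notation c := (@log_cost R m).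

Lemma cyclically_monotone_utility (G : set (V * V)) : measurable G ->
    cyclically_monotone c G -> P G = 1%E ->
  exists u : V -> R, positive_homogeneous u /\ is_utility_for P u.
Proof.
move=> mG cmG PG.
have G0 : G !=set0.
  apply/set0P/eqP => G0; move: PG; rewrite G0 measure0 => /esym/eqP.
  by rewrite onee_eq0.
have [f [freg _ fG]] := monotone_potential cmG G0 (@log_cost_oscillation R m m_ge1).
(* Scaling [x] shifts all its costs by ln t, so regularity applies with [D] equal to ln t and to its
   opposite. *)
have fscale (t : R) (t0 : 0 < t) x : f (pscale t0 x) = ln t + f x.
  apply/eqP; rewrite eq_le addrC freg/=; last first.
    by move=> y; rewrite log_cost_scale// addrC.
  rewrite -lerBrDr; apply: freg => y; rewrite log_cost_scale//.
  lra.
exists (fun x => expR (f x)); split.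
  split=> [x|x t t0]; first exact: expR_gt0.
  by rewrite fscale expRD lnK.
exists (~` G); split.
- exact: measurableC.
- have GC : P (~` G) = 0%E by rewrite probability_setC// PG subee.
  exact: GC.
- apply: subsetC => -[x y] Gxy z /= zy.
  rewrite ltr_expR; have := fG _ z Gxy => /=.
  have : c z y < c x y by rewrite /log_cost ltr_ln ?posrE ?dotp_gt0.
  lra.
Qed.

Lemma utility_cyclically_monotone (u : V -> R) :
    positive_homogeneous u -> is_utility_for P u ->
  exists G : set (V * V),
    [/\ measurable G, cyclically_monotone c G & P G = 1%E].
Proof.
move=> [u0 uhom] [N [mN PN uN]]; exists (~` N); split.
- exact: measurableC.
- apply: (@potential_monotone _ _ _ _ (fun x => ln (u x))) => -[x y] z /= Nxy.
  have dx := dotp_gt0 m_ge1 x y; have dz := dotp_gt0 m_ge1 z y.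
  rewrite /log_cost -!lnM ?posrE// ler_ln ?posrE ?mulr_gt0//.
  (* If the inequality failed, [z] scaled by [u x / u z] would have utility exactly [u x] at a price
     below that of [x], against the utility property [H] of [(x, y)]. *)
  rewrite leNgt; apply/negP => lt_u; apply: Nxy; apply: uN => /= H.
  have t0 : 0 < u x / u z by rewrite divr_gt0.
  have : u (pscale t0 z) < u x.
    apply: H; rewrite (_ : dotp _ y = u x / u z * dotp z y).
      by rewrite mulrAC ltr_pdivrMr// mulrC in lt_u *; rewrite [ltRHS]mulrC.
    by rewrite /dotp mulr_sumr; apply: eq_bigr => i _; rewrite mxE mulrA.
  by rewrite uhom divfK ?ltxx// gt_eqF.
- have PNC : P (~` N) = 1%E.
    by rewrite probability_setC// [X in (_ - X)%E]PN sube0.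
  exact: PNC.
Qed.

End utility.

Theorem theorem4p3 (R : realType) (m : nat) (m_ge1 : (1 <= m)%N)
    (P : probability (posvec R m * posvec R m)%type R)
    (compact_support : exists K : set (posvec R m * posvec R m),
       compact K /\ P K = 1%E)
    (mu nu : probability (posvec R m) R) (P_marginals : coupling mu nu P) :
  [<-> solves_MK mu nu (@log_cost R m) P;
       exists Gamma : set (posvec R m * posvec R m),
         [/\ measurable Gamma, cyclically_monotone (@log_cost R m) Gamma
           & P Gamma = 1%E];
       exists u : posvec R m -> R,
         positive_homogeneous u /\ is_utility_for P u].
Proof.
have [K [cK PK]] := compact_support; have [M KM] := compact_log_box cK.
have PB : P (log_box M `*` log_box M) = 1%E.
  apply: probability1_le PK => //; first exact: compact_measurable_posvec.
  by apply: measurableX; exact: measurable_log_box.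
tfae.
- exact: (optimal_cyclically_monotone m_ge1 P_marginals PB).
- by move=> [G [mG cmG PG]]; exact: (cyclically_monotone_utility m_ge1 mG cmG PG).
- move=> [u [uhom /(utility_cyclically_monotone m_ge1 uhom)[G [mG cmG PG]]]].
  exact: (cyclically_monotone_optimal m_ge1 P_marginals PB mG cmG PG).
Qed.
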